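(* Let $G_1$ and $G_2$ be two graphs with $|V(G_i)|\geq 2$ for $i=1,2$, and let $m=\min\{\gamma_{\{R2\}}(G_1), \gamma_{\{R2\}}(G_2)\}$. Then \begin{enumerate} \item $\gamma_{\{R2\}}(G_1\wedge G_2)=2$ if and only if $m= 2$; \item $\gamma_{\{R2\}}(G_1\wedge G_2)=3$ if and only if either $m=3$, or $m=4$ and $\gamma(G_i)=2$ for some $i\in\{1,2\}$; \item $\gamma_{\{R2\}}(G_1\wedge G_2)=4$ if and only if $m\geq 4$ and $\gamma(G_i)>2$ for $i=1,2$. \end{enumerate}
   Context: All graphs are finite, undirected and simple, with nonempty vertex set. For a graph $G=(V,E)$, a function $f:V\to\{0,1,2\}$ is a Roman $\{2\}$-dominating function of $G$ if for every $v\in V$ with $f(v)=0$, either $v$ has a neighbor $u$ with $f(u)=2$, or $v$ has two distinct neighbors $x,y$ with $f(x)=f(y)=1$. The weight of $f$ is $\sum_{v\in V}f(v)$, and $\gamma_{\{R2\}}(G)$ is the minimum weight of a Roman $\{2\}$-dominating function of $G$. $\gamma(G)$ is the domination number of $G$ (minimum size of a set $D\subseteq V$ such that every vertex not in $D$ has a neighbor in $D$). The join $G_1\wedge G_2$ of two (vertex-disjoint) graphs has vertex set $V(G_1)\cup V(G_2)$ and edge set $E(G_1)\cup E(G_2)$ together with all edges having one endpoint in $V(G_1)$ and the other in $V(G_2)$. *)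

(* Defs.v *)
From mathcomp Require Import all_boot.
Set Implicit Arguments.
Unset Strict Implicit.
Unset Printing Implicit Defensive.

Record sgraph := SGraph {
  vertex :> finType;
  edge : rel vertex;
  edge_sym : symmetric edge;
  edge_irrefl : irreflexive edge;
  vertex_gt0 : 0 < #|vertex| }.

Section Domination.
Variable G : sgraph.

Definition dominating (D : {set G}) : bool :=
  [forall v, (v \notin D) ==> [exists u in D, edge v u]].

(* The seed of the arg min is always dominating, see dominating_setT. *)
Definition domination_number : nat :=
  #|[arg min_(D < [set: G] | dominating D) #|D|]|.

Definition roman2_dominating (f : {ffun G -> 'I_3}) : bool :=
  [forall v, (f v == 0 :> nat) ==>
    [exists u, edge v u && (f u == 2 :> nat)]
    || [exists x, exists y,
         [&& x != y, edge v x, edge v y, f x == 1 :> nat & f y == 1 :> nat]]].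

Definition weight (f : {ffun G -> 'I_3}) : nat := \sum_v f v.

(* The seed, the constant function 2, is always Roman {2}-dominating,
   see roman2_dominating_const2. *)
Definition roman2_number : nat :=
  weight [arg min_(f < [ffun=> ord_max] | roman2_dominating f) weight f].

Lemma dominating_setT : dominating [set: G].
Proof. by apply/forallP => v; rewrite inE. Qed.

Lemma roman2_dominating_const2 : roman2_dominating [ffun=> ord_max].
Proof. by apply/forallP => v; rewrite ffunE. Qed.

Lemma domination_numberP :
  (exists2 D, dominating D & #|D| = domination_number)
  /\ (forall D, dominating D -> domination_number <= #|D|).
Proof.
rewrite /domination_number; case: arg_minnP => [|D domD minD].
  exact: dominating_setT.
by split=> //; exists D.
Qed.

Lemma roman2_numberP :
  (exists2 f, roman2_dominating f & weight f = roman2_number)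
  /\ (forall f, roman2_dominating f -> roman2_number <= weight f).
Proof.
rewrite /roman2_number; case: arg_minnP => [|f domf minf].
  exact: roman2_dominating_const2.
by split=> //; exists f.
Qed.

End Domination.

Section Join.
Variables G1 G2 : sgraph.

Definition join_edge : rel (G1 + G2)%type := fun a b =>
  match a, b with
  | inl x, inl y => edge x y
  | inr x, inr y => edge x y
  | _, _ => true
  end.

Lemma join_edge_sym : symmetric join_edge.
Proof. by move=> [x|x] [y|y] //=; rewrite edge_sym. Qed.

Lemma join_edge_irrefl : irreflexive join_edge.
Proof. by move=> [x|x] /=; rewrite edge_irrefl. Qed.

Lemma join_vertex_gt0 : 0 < #|{: G1 + G2}|.
Proof. by rewrite card_sum addn_gt0 vertex_gt0. Qed.

Definition join : sgraph :=
  SGraph join_edge_sym join_edge_irrefl join_vertex_gt0.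

End Join.

(* Main.v *)
(* Since [f] takes values in {0, 1, 2}, it is Roman {2}-dominating exactly when
   the neighbours of each vertex of value 0 have total value at least 2.  In a
   join, a vertex of one side sees its own neighbours and the whole other side.
   So a Roman {2}-dominating function of the join is a pair of functions of
   weights [w1] and [w2], where each side has to provide only [2 - w] to its
   vertices of value 0 if the other side has weight [w].  For [w = 0] this is
   Roman {2}-domination, for [w = 1] the support is a dominating set, and for
   [w >= 2] there is no condition.  The theorem follows by splitting the weight
   of an optimal function as [w1 + w2], and from
   [roman2_number G <= 2 * domination_number G]. *)
Require Import Defs.
From mathcomp Require Import all_boot.
From mathcomp Require Import zify.

Set Implicit Arguments.
Unset Strict Implicit.
Unset Printing Implicit Defensive.

Section Defence.
Variable G : sgraph.
Implicit Types (f : {ffun G -> 'I_3}) (D : {set G}) (t k : nat).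

(** [t] stands for the weight on the other side of a join, all of which every vertex of [G] sees. *)
Definition defended t f : Prop :=
  forall v, f v = 0 :> nat -> 2 <= \sum_(u | edge v u) f u + t.

Lemma roman2_dominatingP f : roman2_dominating f <-> defended 0 f.
Proof.
split=> [/forallP domf v fv0 | deff].
  rewrite addn0; have := domf v; rewrite fv0 eqxx /=.
  case/orP=> [/existsP[u /andP[vu /eqP fu]] | ].
    by rewrite (bigD1 u) //= fu leq_addr.
  case/existsP=> x /existsP[y /and5P[xy vx vy /eqP fx /eqP fy]].
  by rewrite (bigD1 x) //= fx (bigD1 y) /= ?fy // vy eq_sym.
apply/forallP=> v; apply/implyP=> /eqP fv0.
have := deff v fv0; rewrite addn0 => sum_ge2.
have [// | no2] := boolP [exists u, edge v u && (f u == 2 :> nat)].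
(* With no neighbour of value 2, a neighbourhood sum of at least 2 must come from two distinct
   neighbours of value 1. *)
have le1 u : edge v u -> f u <= 1.
  move=> vu; have := ltn_ord (f u).
  by move: no2; rewrite negb_exists => /forallP/(_ u); rewrite vu /=; lia.
have pos_nbr (P : pred G) : 0 < \sum_(u | edge v u && P u) f u ->
    exists u, [/\ edge v u, P u & f u = 1 :> nat].
  rewrite lt0n sum_nat_eq0 negb_forall => /existsP[u].
  rewrite negb_imply => /andP[/andP[vu Pu] fu]; exists u; split=> //.
  by have := le1 u vu; lia.
have [|x [vx _ fx]] := pos_nbr predT.
  by under eq_bigl do rewrite andbT; lia.
have [|y [vy yx fy]] := pos_nbr (predC1 x).
  by move: sum_ge2; rewrite (bigD1 x) //= fx; lia.
apply/existsP; exists x; apply/existsP; exists y.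
by rewrite eq_sym (yx : y != x) vx vy fx fy.
Qed.

Lemma roman2_number_le f : defended 0 f -> roman2_number G <= weight f.
Proof. by move/roman2_dominatingP; apply: (roman2_numberP G).2. Qed.

(** A vertex of value 0 gets 1 from outside and still needs 1 from its own neighbours, so the
    support of [f] dominates. *)
Lemma domination_number_le f :
  defended 1 f -> domination_number G <= weight f.
Proof.
move=> deff; pose D := [set v | f v != 0 :> nat].
apply: leq_trans ((domination_numberP G).2 D _) _.
  apply/forallP=> v; apply/implyP; rewrite inE negbK => /eqP /deff.
  rewrite addn1 ltnS lt0n sum_nat_eq0 negb_forall => /existsP[u].
  rewrite negb_imply => /andP[vu fu].
  by apply/existsP; exists u; rewrite inE fu.
rewrite -sum1_card /weight big_mkcond leq_sum // => v _.
by rewrite inE; case: eqP => [|/eqP] /=; rewrite ?lt0n.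
Qed.

Definition indicator (c : 'I_3) D : {ffun G -> 'I_3} :=
  [ffun v => if v \in D then c else ord0].

Lemma weight_indicator c D : weight (indicator c D) = #|D| * c.
Proof.
rewrite /weight -sum_nat_const [RHS]big_mkcond.
by apply: eq_bigr => v _; rewrite ffunE; case: ifP.
Qed.

Lemma defended_indicator (c : 'I_3) D t :
  0 < c -> 2 <= c + t -> dominating D -> defended t (indicator c D).
Proof.
move=> c_gt0 ct /forallP domD v; rewrite ffunE.
case: ifPn => [_ /eqP | vD _]; first by rewrite eqn0Ngt c_gt0.
have := domD v; rewrite vD => /existsP[u /andP[uD vu]].
by rewrite (bigD1 u) //= ffunE uD; lia.
Qed.

Lemma defended_ge2 t f : 2 <= t -> defended t f.
Proof. by move=> t2 v _; lia. Qed.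

(** Put the value 2 on a minimum dominating set. *)
Lemma roman2_number_le_double : roman2_number G <= domination_number G * 2.
Proof.
have [[D domD <-] _] := domination_numberP G.
rewrite -(weight_indicator ord_max); apply: roman2_number_le.
exact: defended_indicator.
Qed.

(** A vertex of value 0 already sees weight 2; if there is none, each of the at least two vertices
    has value at least 1. *)
Lemma roman2_number_ge2 : 2 <= #|G| -> 2 <= roman2_number G.
Proof.
move=> G2; have [[f /roman2_dominatingP deff <-] _] := roman2_numberP G.
have [/existsP[v /eqP /deff] | ] := boolP [exists v, f v == 0 :> nat].
  rewrite addn0 => /leq_trans; apply.
  by rewrite /weight [X in _ <= X](bigID (edge v)) leq_addr.
rewrite negb_exists => /forallP fpos; apply: leq_trans G2 _.
by rewrite -sum1_card leq_sum // => v _; rewrite lt0n.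
Qed.

End Defence.

Section JoinNumber.
Variables G1 G2 : sgraph.
Implicit Types (f : {ffun G1 -> 'I_3}) (g : {ffun G2 -> 'I_3}).

Definition join_fun f g : {ffun join G1 G2 -> 'I_3} :=
  [ffun v : (G1 + G2)%type => match v with inl x => f x | inr y => g y end].

Lemma weight_join f g : weight (join_fun f g) = weight f + weight g.
Proof.
rewrite /weight big_sumType.
by congr (_ + _); apply: eq_bigr => v _; rewrite ffunE.
Qed.

Lemma join_fun_surj h : exists f g, h = join_fun f g.
Proof.
exists [ffun x => h (inl x)], [ffun y => h (inr y)].
by apply/ffunP=> -[v|v]; rewrite !ffunE.
Qed.

Lemma defended_join f g :
  defended 0 (join_fun f g) <->
  defended (weight g) f /\ defended (weight f) g.
Proof.
have nbr1 (v : G1) : \sum_(u | edge (inl v : join G1 G2) u) join_fun f g u =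
    \sum_(u | edge v u) f u + weight g.
  rewrite big_sumType /=.
  by congr (_ + _); apply: eq_bigr => u _; rewrite ffunE.
have nbr2 (v : G2) : \sum_(u | edge (inr v : join G1 G2) u) join_fun f g u =
    \sum_(u | edge v u) g u + weight f.
  rewrite big_sumType /= addnC.
  by congr (_ + _); apply: eq_bigr => u _; rewrite ffunE.
split=> [defh | [deff defg] [v|v]].
- split=> v fv0.
    by have := defh (inl v); rewrite ffunE nbr1 addn0; apply.
  by have := defh (inr v); rewrite ffunE nbr2 addn0; apply.
- by rewrite ffunE nbr1 addn0; apply: deff.
- by rewrite ffunE nbr2 addn0; apply: defg.
Qed.

Lemma roman2_number_join_le f g :
  defended (weight g) f -> defended (weight f) g ->
  roman2_number (join G1 G2) <= weight f + weight g.
Proof.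
move=> deff defg; rewrite -weight_join roman2_number_le //.
exact/defended_join.
Qed.

Lemma roman2_number_join_split :
  exists f g, [/\ defended (weight g) f, defended (weight f) g
    & weight f + weight g = roman2_number (join G1 G2)].
Proof.
have [[h /roman2_dominatingP defh <-] _] := roman2_numberP (join G1 G2).
have [f [g eh]] := join_fun_surj h; exists f, g.
by move: defh; rewrite eh weight_join => /defended_join[].
Qed.

Lemma roman2_number_join_le4 : roman2_number (join G1 G2) <= 4.
Proof.
have /card_gt0P[x _] := vertex_gt0 G1; have /card_gt0P[y _] := vertex_gt0 G2.
(* One vertex of value 2 on each side defends the whole other side. *)
have := @roman2_number_join_le (indicator ord_max [set x])
  (indicator ord_max [set y]).
by rewrite !weight_indicator !cards1; apply; apply: defended_ge2.
Qed.

Lemma roman2_number_join_le_l :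
  2 <= #|G1| -> roman2_number (join G1 G2) <= roman2_number G1.
Proof.
move/roman2_number_ge2.
have [[f /roman2_dominatingP deff <-] _] := roman2_numberP G1 => f_ge2.
(* Extend an optimal [f] by the zero function: its weight, at least 2, defends all of [G2]. *)
have := @roman2_number_join_le f (indicator ord0 set0).
rewrite weight_indicator cards0 addn0; apply=> //.
exact: defended_ge2.
Qed.

(** Put 1 on a minimum dominating set of [G1] and on one vertex of [G2]: that vertex supplies the 1
    missing in [G1], and the set supplies at least 2 to [G2]. *)
Lemma roman2_number_join_le_dom : 2 <= domination_number G1 ->
  roman2_number (join G1 G2) <= (domination_number G1).+1.
Proof.
have [[D domD <-] _] := domination_numberP G1 => D_ge2.
have /card_gt0P[y _] := vertex_gt0 G2.
pose one : 'I_3 := Ordinal (isT : 1 < 3).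
have := @roman2_number_join_le (indicator one D) (indicator one [set y]).
rewrite !weight_indicator cards1 /= !muln1 addn1; apply.
  exact: defended_indicator.
exact: defended_ge2.
Qed.

End JoinNumber.

Lemma roman2_number_joinC G1 G2 :
  roman2_number (join G1 G2) = roman2_number (join G2 G1).
Proof.
apply/eqP; rewrite eqn_leq; apply/andP; split.
  have [f2 [f1 [def2 def1 <-]]] := roman2_number_join_split G2 G1.
  by rewrite addnC roman2_number_join_le.
have [f1 [f2 [def1 def2 <-]]] := roman2_number_join_split G1 G2.
by rewrite addnC roman2_number_join_le.
Qed.

Theorem theorem2p1 (G1 G2 : sgraph) (hG1 : 2 <= #|G1|) (hG2 : 2 <= #|G2|) :
  let m := minn (roman2_number G1) (roman2_number G2) in
  [/\ roman2_number (join G1 G2) = 2 <-> m = 2,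
      roman2_number (join G1 G2) = 3 <->
        (m = 3 \/ (m = 4 /\ (domination_number G1 = 2 \/ domination_number G2 = 2)))
    & roman2_number (join G1 G2) = 4 <->
        (4 <= m /\ 2 < domination_number G1 /\ 2 < domination_number G2)].
Proof.
have a_ge2 := roman2_number_ge2 hG1; have b_ge2 := roman2_number_ge2 hG2.
have a_le := roman2_number_le_double G1; have b_le := roman2_number_le_double G2.
have r_le4 := roman2_number_join_le4 G1 G2.
have r_le_a := roman2_number_join_le_l G2 hG1.
have r_le_b := roman2_number_join_le_l G1 hG2.
have r_le_g := @roman2_number_join_le_dom G1 G2.
have r_le_h := @roman2_number_join_le_dom G2 G1.
rewrite roman2_number_joinC in r_le_b; rewrite (roman2_number_joinC G2) in r_le_h.
have [f1 [f2 [def1 def2 r_eq]]] := roman2_number_join_split G1 G2.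
(* If the join has number at most 3, one side has weight at most 1, so one of these four bounds
   applies. *)
have f2_0 : weight f2 = 0 -> roman2_number G1 <= weight f1.
  by move=> w; rewrite w in def1; apply: roman2_number_le.
have f2_1 : weight f2 = 1 -> domination_number G1 <= weight f1.
  by move=> w; rewrite w in def1; apply: domination_number_le.
have f1_0 : weight f1 = 0 -> roman2_number G2 <= weight f2.
  by move=> w; rewrite w in def2; apply: roman2_number_le.
have f1_1 : weight f1 = 1 -> domination_number G2 <= weight f2.
  by move=> w; rewrite w in def2; apply: domination_number_le.
clear def1 def2.
(* Only linear arithmetic on these numbers remains. A split 1 + 1 gives domination number 1, hence
   [m = 2] by doubling; a split 1 + 2 gives domination number at most 2, hence [m <= 4]. *)
move: (weight f1) (weight f2) (roman2_number (join G1 G2)) (roman2_number G1)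
  (roman2_number G2) (domination_number G1) (domination_number G2) r_eq f2_0
  f2_1 f1_0 f1_1 a_ge2 b_ge2 a_le b_le r_le4 r_le_a r_le_b r_le_g r_le_h.
move=> w1 w2 r a b g h r_eq *.
by split; lia.
Qed.
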